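(* If $\mathcal M$ is a semi-simple label then $\mathcal M$ is WAP. If $Q_1,Q_2\in\mathcal E_*(\Theta(\mathcal M))$ then $Q_1Q_2=Q_2Q_1=U$.
   Context: Write $\mathbb N=\{1,2,\dots\}$. An $\mathbb N$-vector is a function $\mathbf m:\mathbb N\to\{0,1,2,\dots\}$ with finite support $\mathrm{supp}\,\mathbf m$; $FIN(\mathbb N)$ is the additive monoid of all $\mathbb N$-vectors, with identity $\mathbf 0$ and the pointwise order. A label is a set $\mathcal M\subset FIN(\mathbb N)$ such that $\mathbf 0\le\mathbf m_1\le\mathbf m\in\mathcal M$ implies $\mathbf m_1\in\mathcal M$. $\mathcal{LAB}$ is the compact space of all labels (including $\emptyset$) with the ultrametric $d(\mathcal M_1,\mathcal M_2)=\inf\{2^{-N}:N\ge0,\ \mathcal M_1\cap\mathcal B_N=\mathcal M_2\cap\mathcal B_N\}$, where $\mathcal B_N$ is the set of $\mathbb N$-vectors $\mathbf m$ with $\mathbf m_\ell<N$ for all $\ell$ and $\mathrm{supp}\,\mathbf m\subset[1,N]$. $FIN(\mathbb N)$ acts continuously on $\mathcal{LAB}$ by $P_{\mathbf r}(\mathcal M)=\mathcal M-\mathbf r=\{\mathbf w\in FIN(\mathbb N):\mathbf w+\mathbf r\in\mathcal M\}$. $\Theta(\mathcal M)$ is the closure of $\{\mathcal M-\mathbf r:\mathbf r\in FIN(\mathbb N)\}$, a closed invariant set. $\mathcal E(\Theta(\mathcal M))$ is the closure of $\mathcal E_0(\Theta(\mathcal M))=\{P_{\mathbf r}|\Theta(\mathcal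 M):\mathbf r\in FIN(\mathbb N)\}$ in $\Theta(\mathcal M)^{\Theta(\mathcal M)}$ with the topology of pointwise convergence, a semigroup under composition; $\mathcal E_*(\Theta(\mathcal M))=\mathcal E(\Theta(\mathcal M))\setminus\mathcal E_0(\Theta(\mathcal M))$ is the set of external elements. $U$ is the map taking all of $\Theta(\mathcal M)$ to $\emptyset$ (it belongs to $\mathcal E(\Theta(\mathcal M))$ when $\mathcal M\ne FIN(\mathbb N)$; for $\mathcal M=FIN(\mathbb N)$ one has $\Theta(\mathcal M)=\{\mathcal M\}$ and $\mathcal E_*=\emptyset$). A label $\mathcal M$ is semi-simple if $Q(\mathcal M)$ is a finite label for every $Q\in\mathcal E_*(\Theta(\mathcal M))$. A label $\mathcal M$ is WAP if every element of $\mathcal E(\Theta(\mathcal M))$ is continuous on $\Theta(\mathcal M)$. *)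

(* Defs.v *)
From HB Require Import structures.
From mathcomp Require Import all_boot all_order all_algebra.
From mathcomp Require Import finmap.
From mathcomp Require Import all_classical all_reals all_analysis.

Set Implicit Arguments.
Unset Strict Implicit.
Unset Printing Implicit Defensive.

Import Order.TTheory GRing.Theory Num.Theory.

Local Open Scope classical_set_scope.
Local Open Scope ring_scope.

(* The index set is {1, 2, ...}: the mathematical N excludes 0. *)
Definition posnat : Type := {n : nat | (0 < n)%N}.
HB.instance Definition _ := Choice.on posnat.

Definition FIN : Type := {fsfun posnat -> nat with 0%N}.
HB.instance Definition _ := Choice.on FIN.

Definition fin_zero : FIN := [fsfun with 0%N].

Definition fin_add (m1 m2 : FIN) : FIN :=
  [fsfun l in (finsupp m1 `|` finsupp m2)%fset => (m1 l + m2 l)%N].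

Lemma finP (m1 m2 : FIN) : (forall l, m1 l = m2 l) -> m1 = m2.
Proof. by move=> h; apply/fsfunP. Qed.

Lemma fin_zeroE l : fin_zero l = 0%N.
Proof. exact: fsfun0E. Qed.

Lemma fin_addE m1 m2 l : fin_add m1 m2 l = (m1 l + m2 l)%N.
Proof.
rewrite /fin_add fsfunE in_fsetU.
by case: finsuppP => // _; case: finsuppP.
Qed.

Lemma fin_addA : associative fin_add.
Proof. by move=> a b c; apply: finP => l; rewrite !fin_addE addnA. Qed.

Lemma fin_addC : commutative fin_add.
Proof. by move=> a b; apply: finP => l; rewrite !fin_addE addnC. Qed.

Lemma fin_add0 : left_id fin_zero fin_add.
Proof. by move=> a; apply: finP => l; rewrite fin_addE fin_zeroE. Qed.

HB.instance Definition _ := GRing.isNmodule.Build FIN fin_addA fin_addC fin_add0.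

Lemma coef0 l : (0 : FIN) l = 0%N. Proof. exact: fin_zeroE. Qed.

Lemma coefD (m1 m2 : FIN) l : (m1 + m2) l = (m1 l + m2 l)%N.
Proof. exact: fin_addE. Qed.

Definition fin_le (m1 m2 : FIN) : Prop := forall l, (m1 l <= m2 l)%N.

Record label := Label {
  label_set : set FIN;
  label_down : forall m1 m, fin_le m1 m -> label_set m -> label_set m1
}.

HB.instance Definition _ := gen_eqMixin label.
HB.instance Definition _ := gen_choiceMixin label.

Lemma label_eq (M1 M2 : label) : label_set M1 = label_set M2 -> M1 = M2.
Proof.
by case: M1 M2 => [A pA] [B pB] /= e; subst B; congr Label; exact: Prop_irrelevance.
Qed.

Definition label0 : label := @Label set0 (fun _ _ _ => id).

Definition finite_label (M : label) : Prop := finite_set (label_set M).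

Lemma shift_subproof (r : FIN) (M : label) (m1 m : FIN) :
  fin_le m1 m -> label_set M (m + r) -> label_set M (m1 + r).
Proof. by move=> h; apply: label_down => l; rewrite !coefD leq_add2r. Qed.

(* P_r(M) = M - r *)
Definition shift (r : FIN) (M : label) : label :=
  @Label [set w | label_set M (w + r)] (@shift_subproof r M).

Definition box (N : nat) : set FIN :=
  [set m | (forall l, (m l < N)%N) /\ (forall l, m l != 0%N -> (sval l <= N)%N)].

Lemma subset_box (N N' : nat) : (N <= N')%N -> box N `<=` box N'.
Proof.
move=> le m [h1 h2]; split=> l.
  exact: leq_trans (h1 l) le.
by move=> /h2 h; exact: leq_trans h le.
Qed.

Lemma box_cover (m : FIN) : exists N, box N m.
Proof.
pose N := (\max_(l <- finsupp m) (m l + sval l)).+1.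
have bound l : l \in finsupp m -> (m l + sval l < N)%N.
  by move=> lm; rewrite ltnS; apply: leq_bigmax_seq.
exists N; split=> l.
  case: (boolP (l \in finsupp m)) => [/bound|].
    by apply: leq_ltn_trans; rewrite leq_addr.
  by move=> /fsfun_dflt ->.
rewrite -mem_finsupp => /bound/ltnW; apply: leq_trans.
by rewrite leq_addl.
Qed.

(* The distance is real-valued, hence the parameter R. *)
Definition LAB (R : realType) : Type := label.

Section metric.
Variable R : realType.
Implicit Types x y z : label.

Definition agree x y : set nat :=
  [set N | label_set x `&` box N = label_set y `&` box N].

Definition lab_dist x y : R := inf [set 2 ^- N | N in agree x y].

Lemma agree0 x y : agree x y 0%N.
Proof.
have b0 : box 0 = set0.
  rewrite -subset0 => m [/(_ (exist _ 1%N isT))]; by rewrite ltn0.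
by rewrite /agree /= b0 !setI0.
Qed.

Lemma agree_le x y N N' : (N <= N')%N -> agree x y N' -> agree x y N.
Proof.
move=> le; rewrite /agree /= => h.
have -> : box N = box N' `&` box N by rewrite setIidr //; exact: subset_box.
by rewrite (setIA (label_set x)) (setIA (label_set y)) h.
Qed.

Lemma lab_dist_lb x y N : agree x y N -> lab_dist x y <= 2 ^- N.
Proof.
move=> h; apply: ge_inf; last by exists N.
by exists 0 => _ [k _ <-]; rewrite invr_ge0 exprn_ge0.
Qed.

Lemma lab_dist_glb x y c : (forall N, agree x y N -> c <= 2 ^- N) ->
  c <= lab_dist x y.
Proof.
move=> h; apply: lb_le_inf; last by move=> _ [N /h ? <-].
by exists (2 ^- 0); exists 0%N => //; exact: agree0.
Qed.

Lemma lab_dist_ge0 x y : 0 <= lab_dist x y.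
Proof. by apply: lab_dist_glb => N _; rewrite invr_ge0 exprn_ge0. Qed.

Lemma expn_lt e : 0 < e -> exists N, (2 ^- N : R) < e.
Proof.
move=> e0; exists (Num.truncn e^-1).+1.
rewrite invf_plt ?posrE ?exprn_gt0 //.
apply: lt_le_trans (truncnS_gt _) _.
by rewrite -natrX ler_nat ltnW // ltn_expl.
Qed.

Lemma lab_dist_lt x y N : lab_dist x y < 2 ^- N -> agree x y N.
Proof.
apply: contraPP => xyN; apply/negP; rewrite -leNgt.
apply: lab_dist_glb => k xyk.
have kN : (k <= N)%N.
  by rewrite leqNgt; apply/negP => /ltnW /agree_le /(_ xyk).
by rewrite lef_pV2 ?posrE ?exprn_gt0 // ler_eXn2l ?ltr1n.
Qed.

Lemma lab_distxx x : lab_dist x x = 0.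
Proof.
apply/eqP; rewrite eq_le lab_dist_ge0 andbT; apply/ler_addgt0Pl => e e0.
have [N Ne] := expn_lt e0; rewrite addr0; apply: le_trans (ltW Ne).
exact: lab_dist_lb.
Qed.

Lemma lab_dist_sym x y : lab_dist x y = lab_dist y x.
Proof.
by rewrite /lab_dist; congr (inf [set _ | _ in _]); apply/seteqP; split=> N /esym.
Qed.

Lemma lab_dist_positivity x y : lab_dist x y = 0 -> x = y.
Proof.
move=> d0; apply: label_eq; apply/funext => m; apply/propext.
have [N Nm] := box_cover m.
have xyN : agree x y N by apply: lab_dist_lt; rewrite d0 invr_gt0 exprn_gt0.
have := congr1 (@^~ m) xyN; rewrite /setI /= => E.
by split=> h; [have : label_set x m /\ box N m by []; rewrite E|
  have : label_set y m /\ box N m by []; rewrite -E] => -[].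
Qed.

Lemma lab_dist_triangle y x z : lab_dist x z <= lab_dist x y + lab_dist y z.
Proof.
rewrite -lerBlDr; apply: lab_dist_glb => a xya.
rewrite lerBlDr addrC -lerBlDr; apply: lab_dist_glb => b yzb.
rewrite lerBlDr.
have h : agree x z (minn a b).
  rewrite /agree /= (agree_le (geq_minl a b) xya).
  exact: (agree_le (geq_minr a b) yzb).
apply: le_trans (lab_dist_lb h) _.
by case: leqP => _; rewrite ?lerDl ?lerDr invr_ge0 exprn_ge0.
Qed.

HB.instance Definition _ := Choice.on (LAB R).
HB.instance Definition _ := isMetric.Build R (LAB R)
  lab_distxx lab_dist_positivity lab_dist_sym lab_dist_triangle.

End metric.

Section enveloping_semigroup.
Variable R : realType.
Implicit Type M : LAB R.

Definition Theta M : set (LAB R) :=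
  closure [set (shift r M : LAB R) | r in [set: FIN]].
Arguments Theta : clear implicits.

(* Theta M as a space of its own, with the topology induced by LAB R *)
Definition ThetaT M : Type :=
  initial_topology (val : set_type (Theta M) -> LAB R).
HB.instance Definition _ M := Topological.copy (ThetaT M)
  (initial_topology (val : set_type (Theta M) -> LAB R)).

Definition pt M (x : ThetaT M) : LAB R := val (x : set_type (Theta M)).

Lemma Theta_self M : Theta M M.
Proof.
apply: subset_closure; exists 0 => //.
by apply: label_eq; apply/funext => w; rewrite /= addr0.
Qed.

Definition base M : ThetaT M := exist _ M (mem_set (@Theta_self M)).

Lemma shift_add r s (M : label) : shift r (shift s M) = shift (r + s) M.
Proof. by apply: label_eq; apply/funext => w /=; rewrite addrA. Qed.

Lemma shift_continuous r : continuous (shift r : LAB R -> LAB R).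
Proof.
move=> M B /nbhs_ballP[e /= e0 sB].
have [N Ne] := expn_lt e0; have [K [rK suppK]] := box_cover r.
have d0 : 0 < (2 ^- (N + K) : R) by rewrite invr_gt0 exprn_gt0.
apply/nbhs_ballP; exists (2 ^- (N + K)) => // M'.
rewrite ballEmdist /= => /lab_dist_lt E; apply: sB.
rewrite ballEmdist /=; apply: le_lt_trans Ne.
apply: lab_dist_lb; apply/funext => w; apply/propext.
have bw : box N w -> box (N + K) (w + r).
  move=> [h1 h2]; split=> l; first by rewrite coefD -addnS leq_add // ltnW.
  rewrite coefD addn_eq0 negb_and => /orP[/h2|/suppK] h; apply: leq_trans h _.
    exact: leq_addr.
  exact: leq_addl.
have := congr1 (@^~ (w + r)) E; rewrite /setI /= => Ew.
split=> -[Mw wN]; split=> //; have wr := bw wN.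
  by have : label_set M (w + r) /\ box (N + K) (w + r) by []; rewrite Ew => -[].
by have : label_set M' (w + r) /\ box (N + K) (w + r) by []; rewrite -Ew => -[].
Qed.

Lemma Theta_shift M r N : Theta M N -> Theta M (shift r N).
Proof.
move=> h B /shift_continuous /h [_ [[s _ <-] Bs]].
exists (shift r (shift s M)); split=> //.
by exists (r + s) => //; rewrite shift_add.
Qed.

Definition P M (r : FIN) (x : ThetaT M) : ThetaT M :=
  exist _ (shift r (pt x)) (mem_set (@Theta_shift M r _ (set_valP x))).
Arguments P : clear implicits.

Definition E0 M : set {ptws ThetaT M -> ThetaT M} := range (P M).
Arguments E0 : clear implicits.

Definition E M : set {ptws ThetaT M -> ThetaT M} := closure (E0 M).
Arguments E : clear implicits.

Definition Estar M : set {ptws ThetaT M -> ThetaT M} := E M `\` E0 M.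
Arguments Estar : clear implicits.

(* The codomain is LAB R rather than ThetaT M because the empty label lies
   outside Theta M when M is all of FIN. *)
Definition U M : ThetaT M -> LAB R := fun=> label0.
Arguments U : clear implicits.

Definition semi_simple M : Prop :=
  forall Q, Estar M Q -> finite_label (pt (Q (base M))).

Definition WAP M : Prop :=
  forall Q : ThetaT M -> ThetaT M, E M (Q : {ptws _ -> _}) -> continuous Q.

End enveloping_semigroup.

Arguments Theta {R} M _.
Arguments P {R} M r x.
Arguments E0 {R} M _.
Arguments E {R} M _.
Arguments Estar {R} M _.
Arguments U {R} M _.

(* Main.v *)
Require Import Defs.
From mathcomp Require Import all_boot all_order all_algebra.
From mathcomp Require Import finmap.
From mathcomp Require Import all_classical all_reals all_analysis.

(** Ultrafilters on the monoid of N-vectors parametrize everything.  Write F-lim x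
for the limit along an ultrafilter F of the translates x - r; the labels form a
closed subset of a Cantor cube, so it always exists, and it is given
coordinatewise: w belongs to F-lim x when x contains w + r for F-almost all r
(this is [ulim] below).  Then Theta(M) is exactly the set of all F-lim M
([Theta_ulimP]), and the elements of the enveloping semigroup are exactly the
maps F-lim on Theta(M) ([E_ulimP]).

Semi-simplicity forces a dichotomy ([semi_simple_ulim]).  Either F-lim is a
single translation on all of Theta(M), or F-lim is external; in the latter case
F is not principal, F-lim M is finite, and F-lim sends every finite label to
the empty label: if w stayed in F-lim x, the finite set of those r with w + r in
x would be F-large, making F principal.

Any two such limits therefore commute on M ([semi_simple_ulimC]): a translation
commutes with every F-lim, and two external limits both compose to the empty
label.  This has two consequences.

Products: a point of Theta(M) is y = H-lim M, so Q2 y = H-lim (Q2 M) for every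
external Q2.  This is a subset of the finite label Q2 M, hence finite, and an
external Q1 sends it to the empty label.

Continuity: commuting gives Q(H-lim M) = H-lim (Q M), so the graph of Q is the
closure of the pairs (M - s, Q M - s).  If some coordinate of Q failed to be
locally constant at x, then x would be a limit of translates M - s along which
that coordinate of Q M - s differs from that of Q x; an ultrafilter
concentrated on these s contradicts the formula at x. *)

Import Order.TTheory GRing.Theory Num.Theory.

Local Open Scope ring_scope.
Local Open Scope classical_set_scope.

(* Distinguishes P_r from the translation y |-> y + x of the same name. *)
Local Notation shift := Defs.shift.

(** * Ultrafilters and convergence of labels *)

(** Otherwise the complements of the finitely many points of A, hence that of A
itself, would all be F-large. *)
Lemma ultra_finite {T : choiceType} (F : set_system T) (A : set T) :
  UltraFilter F -> finite_set A -> F A -> exists2 t, A t & F [set t].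
Proof.
move=> FU finA FA; apply: contrapT => noF.
have nF t : A t -> F (~` [set t]).
  move=> At; have [Ft|//] := in_ultra_setVsetC [set t] FU.
  by case: noF; exists t.
suff : F (A `&` ~` A) by rewrite setICr; exact: filter_not_empty.
apply: filterI => //.
rewrite (_ : ~` A = \bigcap_(t in [set` fset_set A]) ~` [set t]).
  by apply: filter_bigI => t; rewrite in_fset_set // => /set_mem /nF.
rewrite fset_setK //; apply/seteqP; split=> [t nAt u Au /= tu|t nt At].
  by apply: nAt; rewrite tu.
exact: nt At _.
Qed.

Lemma closure_image_ultra {T : Type} {S : topologicalType} (f : T -> S)
    (A : set T) (p : S) :
  closure (f @` A) p ->
  exists F, [/\ UltraFilter F, F A & f @ F --> p].
Proof.
move=> clp.
pose G := filter_from (nbhs p) (fun B => A `&` f @^-1` B).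
have GF : ProperFilter G.
  apply: filter_from_proper; last first.
    by move=> B /clp [_ [[t At <-] Bft]]; exists t.
  apply: filter_from_filter; first by exists setT; exact: filterT.
  move=> B C pB pC; exists (B `&` C); first exact: filterI.
  by move=> t [At [Bt Ct]].
have [F [FU GsubF]] := ultraFilterLemma GF.
exists F; split=> //.
  by apply: GsubF; exists setT; [exact: filterT|move=> t []].
by move=> B pB; apply: GsubF; exists B => // t [].
Qed.

(** This is what makes convergence of labels a coordinatewise matter.  An
N-vector in the box is recovered from its restriction to the indices up to N. *)
Lemma finite_box N : finite_set (box N).
Proof.
pose g (m : FIN) : {ffun 'I_N.+1 -> 'I_N.+1} := [ffun i : 'I_N.+1 =>
  if insub (val i) is Some l then inord (m (l : posnat)) else ord0].
(* Restriction to small indices is injective on the box only, so vectors outside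
   it are sent to a separate value. *)
pose h m := if `[< box N m >] then Some (g m) else None.
have -> : box N = h @^-1` [set o | o != None].
  by apply/seteqP; split=> m /=; rewrite /h; case: asboolP.
apply: finite_preimage finite_finset => m1 m2.
rewrite !inE /= /h; case: asboolP => // -[b1 s1] _.
case: asboolP => // -[b2 s2] _ [] /ffunP e; apply: finP => l.
have [lN|Nl] := leqP (sval l) N.
  have lN' : (sval l < N.+1)%N by [].
  have := congr1 val (e (Ordinal lN')); rewrite !ffunE /=.
  rewrite insubT; first exact: (svalP l).
  move=> p; rewrite (_ : Sub (sval l) p = l); last exact: val_inj.
  by rewrite /= !inordK // ltnW // ltnS.
have z m : (forall l, m l != 0%N -> (sval l <= N)%N) -> m l = 0%N.
  by move=> s; apply/eqP; apply: contraTT Nl => /s; rewrite -leqNgt.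
by rewrite !z.
Qed.

Section label_limits.
Variable R : realType.

(** The metric topology is that of a product of discrete two-point spaces:
agreeing up to a given distance prescribes finitely many coordinates. *)
Lemma cvg_labelP {T : Type} (F : set_system T) (f : T -> LAB R) (x : LAB R) :
  Filter F ->
  f @ F --> x <->
  forall w, \forall t \near F, label_set (f t) w <-> label_set x w.
Proof.
move=> FF; split=> [fx w|fx].
  have [N Nw] := box_cover w.
  have e0 : 0 < (2 ^- N : R) by rewrite invr_gt0 exprn_gt0.
  have nb : nbhs x (ball x (2 ^- N)) by exact: nbhsx_ballx.
  have {}fx : F (f @^-1` ball x (2 ^- N)) by exact: fx.
  apply: (filterS _ fx) => t; rewrite /= ballEmdist /= => /lab_dist_lt E.
  have := congr1 (@^~ w) E; rewrite /setI /= => Ew.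
  by split=> h; [have : label_set (f t) w /\ box N w by []; rewrite -Ew|
    have : label_set x w /\ box N w by []; rewrite Ew] => -[].
move=> B /nbhs_ballP[e /= e0 sB].
have [N Ne] := expn_lt e0.
have fN : F (\bigcap_(w in [set` fset_set (box N)])
    [set t | label_set (f t) w <-> label_set x w]).
  by apply: filter_bigI => w _; exact: fx.
rewrite (fset_setK (finite_box N)) in fN.
suff : F (f @^-1` B) by [].
apply: filterS fN => t ft; apply: sB; rewrite ballEmdist /=.
apply: le_lt_trans Ne; apply: lab_dist_lb.
by apply/seteqP; split=> w [xw wN]; split=> //; apply/(ft w wN).
Qed.

(** * Limits of translates along an ultrafilter *)

Lemma ulim_subproof (F : set_system FIN) (FF : Filter F) (x : label)
    (m1 m : FIN) :
  fin_le m1 m -> F [set r | label_set x (m + r)] ->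
  F [set r | label_set x (m1 + r)].
Proof.
by move=> le; apply: filterS => r; exact: (@shift_subproof r x).
Qed.

(** The limit of the translates of x along F, once F is an ultrafilter
([cvg_shiftP]). *)
Definition ulim (F : set_system FIN) {FF : Filter F} (x : label) : label :=
  @Label [set w | F [set r | label_set x (w + r)]] (@ulim_subproof F FF x).

(** An ultrafilter decides each coordinate. *)
Lemma near_ulim (F : set_system FIN) {FF : UltraFilter F} (x : label) (w : FIN) :
  F [set r | label_set (shift r x) w <-> label_set (ulim F x) w].
Proof.
have [Fw|Fw] := in_ultra_setVsetC [set r | label_set x (w + r)] FF.
  by move: (Fw); apply: filterS.
move: (Fw); apply: filterS => r /= nrw; split=> // Fw'.
by have [? []] := filter_ex (filterI Fw Fw').
Qed.

Lemma cvg_shiftP (F : set_system FIN) {FF : UltraFilter F} (x y : LAB R) :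
  ((fun r => shift r x : LAB R) @ F --> y) <-> y = ulim F x.
Proof.
rewrite cvg_labelP; split=> [h|-> w]; last exact: near_ulim.
apply: label_eq; apply/funext => w; apply/propext.
by have [r [/= <- <-]] := filter_ex (filterI (h w) (near_ulim F x w)).
Qed.

Lemma ulim_shift (F : set_system FIN) {FF : Filter F} (s : FIN) (x : label) :
  ulim F (shift s x) = shift s (ulim F x).
Proof.
apply: label_eq; apply/funext => w /=; congr F.
by apply/funext => r /=; rewrite addrAC.
Qed.

(** One r with w + r in x suffices, since labels are closed downwards. *)
Lemma ulim_sub (F : set_system FIN) {FF : ProperFilter F} (x : label) :
  label_set (ulim F x) `<=` label_set x.
Proof.
move=> w /= /filter_ex[r /=]; apply: label_down => l.
by rewrite Defs.coefD leq_addr.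
Qed.

Lemma ulim_principal (F : set_system FIN) {FF : ProperFilter F} (s : FIN)
    (x : label) :
  F [set s] -> ulim F x = shift s x.
Proof.
move=> Fs; apply: label_eq; apply/seteqP; split=> w /=.
  by move=> Fw; have [_ [/= -> ]] := filter_ex (filterI Fs Fw).
by move=> sw; move: Fs; apply: filterS => _ /= ->.
Qed.

Lemma addFI (w : FIN) : injective (fun r : FIN => w + r).
Proof.
move=> r s /= e; apply: finP => l.
by have := congr1 (fun m : FIN => m l) e; rewrite /= !Defs.coefD => /addnI.
Qed.

(** If w remained in the limit, the r with w + r in x would form a finite
F-large set, so F would be principal. *)
Lemma ulim_finite (F : set_system FIN) {FF : UltraFilter F} (x : label) :
  finite_label x -> (forall s, ~ F [set s]) -> ulim F x = label0.
Proof.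
move=> finx nF; apply: label_eq; rewrite -subset0 => w /= Fw.
have [|s _ /nF//] := ultra_finite _ _ FF _ Fw.
apply: (finite_preimage (f := fun r : FIN => w + r)) finx => r s _ _.
exact: addFI.
Qed.

(** * The orbit closure and its enveloping semigroup *)

Section enveloping.
Variable M : LAB R.

(** An ultrafilter containing, for each neighbourhood of x, the r that bring M
into it has limit x; conversely every ultrafilter converges, by compactness. *)
Lemma Theta_ulimP (x : LAB R) :
  Theta M x <-> exists F (FF : UltraFilter F), x = ulim F M.
Proof.
split=> [/closure_image_ultra[F [FF _ Fx]]|[F [FF /cvg_shiftP Fx]]].
  by exists F, FF; apply/cvg_shiftP.
move=> B /Fx FB.
have /filter_ex[r Br] : F ((fun r => shift r M) @^-1` B) by exact: FB.
by exists (shift r M); split=> //; exists r.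
Qed.

Lemma cvg_ptP {T : Type} (F : set_system T) (f : T -> ThetaT M) (x : ThetaT M) :
  Filter F -> f @ F --> x <-> (fun t => pt (f t)) @ F --> pt x.
Proof.
move=> FF; split=> [fx|fx].
  apply: cvg_comp fx _.
  exact: (@initial_continuous _ _ (val : set_type (Theta M) -> LAB R)).
move=> B [_ [[C oC <-]] /= Cx] /filterS; apply.
by apply: fx; exact: open_nbhs_nbhs.
Qed.

(** Pointwise convergence along F of the translations to Q is, at each point,
convergence in the space of labels, whose limit is [ulim F]. *)
Lemma E_ulimP (Q : ThetaT M -> ThetaT M) :
  E M Q <-> exists F (FF : UltraFilter F), forall x, pt (Q x) = ulim F (pt x).
Proof.
split=> [/closure_image_ultra[F [FF _ FQ]]|[F [FF FQ]]].
  exists F, FF => x; apply/cvg_shiftP.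
  have /cvg_ptP : (fun r => P M r x) @ F --> Q x.
    have px : continuous (fun q : {ptws ThetaT M -> ThetaT M} => q x).
      exact: (@proj_continuous (ThetaT M) (fun=> ThetaT M) x).
    exact: (@cvg_comp _ _ _ (P M) (fun q : {ptws _ -> _} => q x) _ _ _
      FQ (px Q)).
  exact.
have {}FQ : P M @ F --> (Q : {ptws _ -> _}).
  apply/cvg_sup => x B [_ [[C oC <-]] /= Cx] sB.
  have FC : F ((fun r => P M r x) @^-1` C).
    suff FQx : (fun r => P M r x) @ F --> Q x.
      by apply: FQx; exact: open_nbhs_nbhs.
    by apply/cvg_ptP/cvg_shiftP.
  suff : F (P M @^-1` B) by [].
  by apply: filterS FC => r; exact: sB.
move=> B /FQ FB.
have /filter_ex[r Br] : F (P M @^-1` B) by exact: FB.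
by exists (P M r); split=> //; exists r.
Qed.

Lemma Theta_ulim (F : set_system FIN) {FF : UltraFilter F} (x : LAB R) :
  Theta M x -> Theta M (ulim F x).
Proof.
move=> Tx; have Fx := (cvg_shiftP F x (ulim F x)).2 erefl.
have clT : closed (Theta M) by exact: closed_closure.
apply: clT => B /Fx FB.
have /filter_ex[r Br] : F ((fun r => shift r x) @^-1` B) by exact: FB.
by exists (shift r x); split=> //; exact: Theta_shift.
Qed.

(** [ulim F] as an element of the enveloping semigroup, so that semi-simplicity
applies to it. *)
Definition Pulim (F : set_system FIN) {FF : UltraFilter F} (x : ThetaT M) :
    ThetaT M :=
  exist _ (ulim F (pt x) : LAB R) (mem_set (@Theta_ulim F FF _ (set_valP x))).

Lemma pt_inj : injective (@pt R M).
Proof. by move=> x y; exact: val_inj. Qed.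

(** An external map cannot come from a principal ultrafilter, as that would make
it a translation. *)
Lemma Estar_ulim_finite (Q : ThetaT M -> ThetaT M) (F : set_system FIN)
    {FF : UltraFilter F} (x : label) :
  Estar M Q -> (forall y, pt (Q y) = ulim F (pt y)) -> finite_label x ->
  ulim F x = label0.
Proof.
move=> [_ nQ] QF finx; apply: ulim_finite finx _ => s Fs; apply: nQ.
exists s => //; apply/funext => y; apply: pt_inj.
by rewrite QF (ulim_principal _ s).
Qed.

(** * Semi-simple labels *)

(** The dichotomy between internal and external limits.  In the first case F
may well be non-principal: only the map it induces on Theta(M) is a
translation. *)
Lemma semi_simple_ulim (F : set_system FIN) {FF : UltraFilter F} :
  semi_simple M ->
  (exists s, forall x : LAB R, Theta M x -> ulim F x = shift s x) \/
  (finite_label (ulim F M) /\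
   forall x, finite_label x -> ulim F x = label0).
Proof.
move=> ssM; have [[s _ sF]|nF] := pselect (E0 M (Pulim F)); [left|right].
  exists s => x Tx.
  exact: (congr1 (fun Q => pt (Q (exist _ x (mem_set Tx)))) (esym sF)).
have EF : Estar M (Pulim F) by split=> //; apply/E_ulimP; exists F, FF.
split; first exact: (ssM _ EF).
by move=> x; apply: Estar_ulim_finite EF _.
Qed.

(** Translations commute with every limit, and two external limits both compose
to the empty label. *)
Lemma semi_simple_ulimC (F G : set_system FIN) {FF : UltraFilter F}
    {FG : UltraFilter G} :
  semi_simple M -> ulim F (ulim G M) = ulim G (ulim F M).
Proof.
move=> ssM.
have [[s sF]|[finF F0]] := semi_simple_ulim F ssM.
  rewrite !sF ?ulim_shift //; first exact: Theta_self.
  by apply: Theta_ulim; exact: Theta_self.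
have [[s sG]|[finG G0]] := semi_simple_ulim G ssM; last by rewrite F0 // G0.
rewrite !sG ?ulim_shift //; first by apply: Theta_ulim; exact: Theta_self.
exact: Theta_self.
Qed.

(** The commutation lemma read on coordinates: Q(G-lim M) is the limit along G of
the translates of Q M. *)
Lemma semi_simple_near (Q : ThetaT M -> ThetaT M) (G : set_system FIN)
    {FG : UltraFilter G} (y : ThetaT M) (w : FIN) :
  semi_simple M -> E M Q -> pt y = ulim G M ->
  G [set s | label_set (pt (Q (base M))) (w + s) <-> label_set (pt (Q y)) w].
Proof.
move=> ssM /E_ulimP[F [FF QF]] yG.
by rewrite !QF yG semi_simple_ulimC //; exact: near_ulim.
Qed.

(** If coordinate w of Q jumps at points arbitrarily near x, it already does so
at translates of M converging to x, and an ultrafilter carried by these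
contradicts [semi_simple_near] at x. *)
Lemma semi_simple_WAP : semi_simple M -> WAP M.
Proof.
move=> ssM Q EQ x.
have xF : Filter (nbhs x) := nbhs_filter x.
suff Qx w : \forall y \near x,
    label_set (pt (Q y)) w <-> label_set (pt (Q x)) w.
  by apply/(cvg_ptP _ _ _ xF)/(cvg_labelP _ _ _ xF).
apply: contrapT => nx.
pose A := [set s | ~ (label_set (pt (Q (base M))) (w + s) <->
                      label_set (pt (Q x)) w)].
have : closure ((fun s => shift s M : LAB R) @` A) (pt x).
  (* The interior of B is used because a neighbourhood of x must also be one of
     the nearby points y, which are approximated by translates in turn. *)
  move=> B /nbhs_interior xB; apply: contrapT => AB; apply: nx.
  have ptx : (fun y => pt y) @ x --> pt x.
    by apply/(cvg_ptP _ _ _ xF); exact: cvg_id.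
  move: (ptx _ xB : \forall y \near x, B° (pt y)).
  apply: filterS => y By; apply: contrapT => nw; apply: AB.
  have [H [FH yH]] := (Theta_ulimP (pt y)).1 (set_valP y).
  have HB : H ((fun s => shift s M : LAB R) @^-1` B).
    exact: (cvg_shiftP H M (pt y)).2 yH _ By.
  have [s [/= Bs sw]] :=
    filter_ex (filterI HB (semi_simple_near Q H y w ssM EQ yH)).
  by exists (shift s M); split=> //; exists s => // sQ; apply: nw; rewrite -sw.
move=> /closure_image_ultra[G [FG GA /cvg_shiftP xG]].
by have [s []] := filter_ex (filterI GA (semi_simple_near Q G x w ssM EQ xG)).
Qed.

(** For y = H-lim M the label Q2 y = H-lim (Q2 M) lies inside the finite label
Q2 M, so the external map Q1 empties it. *)
Lemma semi_simple_Estar_comp (Q1 Q2 : ThetaT M -> ThetaT M) :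
  semi_simple M -> Estar M Q1 -> Estar M Q2 ->
  pt (M := M) \o (Q1 \o Q2) = U M.
Proof.
move=> ssM E1 E2.
have [/E_ulimP[F [FF QF]] _] := E1; have [/E_ulimP[G [FG QG]] _] := E2.
apply/funext => y; rewrite /= QF.
apply: Estar_ulim_finite E1 QF _; rewrite QG.
have [H [FH ->]] := (Theta_ulimP (pt y)).1 (set_valP y).
rewrite semi_simple_ulimC //; apply: sub_finite_set (ulim_sub H _) _.
by have := ssM _ E2; rewrite QG.
Qed.

End enveloping.
End label_limits.

Theorem theorem4p7 (R : realType) (M : LAB R) (hM : semi_simple M) :
  WAP M /\
  (forall Q1 Q2 : ThetaT M -> ThetaT M, Estar M Q1 -> Estar M Q2 ->
     pt (M:=M) \o (Q1 \o Q2) = U M /\ pt (M:=M) \o (Q2 \o Q1) = U M).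
Proof.
split; first exact: semi_simple_WAP.
by move=> Q1 Q2 E1 E2; split; exact: semi_simple_Estar_comp.
Qed.
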